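(* Let $n\ge2$. The clique numbers of the symmetric and the antisymmetric quantum graphs on $M_n$ are $$\omega(G^{\mathrm{sym}})=\omega(G^{\mathrm{asym}})=\left\lceil\frac n2\right\rceil.$$
   Context: $M_n=M_n(\mathbb C)$; ''projector'' means orthogonal projector. $G^{\mathrm{sym}}$ is the quantum graph on $M_n$ with adjacency operator $x\mapsto\tfrac12(\mathrm{Tr}(x)I+x^{T})-\tfrac1nx$ and operator space $S=\{x\in M_n:x^T=x,\ \mathrm{Tr}(x)=0\}$. $G^{\mathrm{asym}}$ is the quantum graph on $M_n$ with adjacency operator $x\mapsto\tfrac12(\mathrm{Tr}(x)I-x^{T})$ and operator space $S=\{x\in M_n:x^T=-x\}$. A $k$-clique of a quantum graph with operator space $S$ is a projector $P\in M_n$ of rank $k$ such that $P(S\oplus\mathbb CI)P=PM_nP$; equivalently, an isometry $V\colon\mathbb C^k\to\mathbb C^n$ with $V^\dagger(S\oplus\mathbb CI)V=M_k$. The clique number $\omega$ is the largest $k$ for which a $k$-clique exists. *)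

(* Defs.v *)
From HB Require Import structures.
From mathcomp Require Import all_boot all_order all_algebra.
From mathcomp Require Import boolp.
From mathcomp Require Import ring.

Set Implicit Arguments.
Unset Strict Implicit.
Unset Printing Implicit Defensive.

Import Order.TTheory GRing.Theory Num.Theory.
Local Open Scope ring_scope.
Local Open Scope sesquilinear_scope.

Section SchurProduct.
Variables (C : numClosedFieldType) (n : nat).
Implicit Types (A B : 'M[C]_n -> 'M[C]_n) (x : 'M[C]_n).

(* The quantum Schur product A . B = m (A (x) B) m^*, where m is the
   multiplication of M_n and m^*(e_ij) = \sum_k e_ik (x) e_kj is its adjoint for
   the inner product Tr(x^* y). It is given here by its values on e_ij. *)
Definition schur_prod A B (i j : 'I_n) : 'M[C]_n :=
  \sum_k A (delta_mx i k) *m B (delta_mx k j).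

(* If A(x) = \sum_a K_a x K_a^* with the K_a orthonormal for Tr(x^* y), this is
   x |-> \sum_a Tr(K_a^* x) K_a, the orthogonal projection onto the span of the
   K_a. *)
Definition space_proj A x : 'M[C]_n :=
  \sum_i \sum_j A (delta_mx i j) *m x *m delta_mx j i.

End SchurProduct.

(* (Undirected, loopless) quantum graphs on M_n, normalised with respect to Tr:
   the complete graph with loops has adjacency operator x |-> Tr(x) I. *)
Record quantum_graph (C : numClosedFieldType) (n : nat) := QuantumGraph {
  adjacency : 'End('M[C]_n);
  opspace : {vspace 'M[C]_n};
  adjacency_idem : forall i j,
    schur_prod adjacency adjacency i j = adjacency (delta_mx i j);
  adjacency_real : forall x, adjacency (x ^t*) = (adjacency x) ^t*;
  adjacency_undirected : forall x y,
    \tr (adjacency x *m y) = \tr (x *m adjacency y);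
  adjacency_loopless : forall i j, schur_prod adjacency id i j = 0;
  opspaceP : forall x, (x \in opspace) = (space_proj adjacency x == x)
}.

Section Clique.
Variables (C : numClosedFieldType) (n : nat).
Implicit Types (G : quantum_graph C n) (P : 'M[C]_n).

Definition projector P := P *m P = P /\ P ^t* = P.

Definition compress P : 'End('M[C]_n) := linfun (mulmx P \o mulmxr P).

Lemma compressE P x : compress P x = P *m x *m P.
Proof. by rewrite lfunE /= mulmxA. Qed.

Definition is_clique G (k : nat) P :=
  [/\ projector P, \rank P = k
    & (compress P @: (opspace G + <[1%:M]>) = compress P @: fullv)%VS].

Definition clique_number G : nat :=
  (\max_(k < n.+1 | `[< exists P, is_clique G k P >]) k)%N.

Lemma clique_numberP G :
  (exists P, is_clique G (clique_number G) P) /\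
  (forall k P, is_clique G k P -> (k <= clique_number G)%N).
Proof.
split; last first.
  move=> k P cP; have kn : (k < n.+1)%N.
    by case: cP => _ <- _; rewrite ltnS rank_leq_row.
  rewrite /clique_number; apply: (@leq_bigmax_cond _ _ _ (Ordinal kn)).
  by apply/asboolP; exists P.
have c0 : `[< exists P, is_clique G (ord0 : 'I_n.+1) P >].
  apply/asboolP; exists 0; split.
  - by split; [rewrite mul0mx | rewrite trmx0 map_mx0].
  - by rewrite mxrank0.
  - have -> : compress 0 = 0 by apply/lfunP => x; rewrite compressE !mul0mx lfunE.
    by rewrite !lim0g.
rewrite /clique_number (bigop.bigmax_eq_arg _ c0).
by case: arg_maxnP => // k /asboolP.
Qed.

Lemma opspace_trace0 G x : x \in opspace G -> \tr x = 0.
Proof.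
rewrite opspaceP => /eqP <-; rewrite /space_proj exchange_big raddf_sum /=.
apply: big1 => j _; rewrite raddf_sum /=.
under eq_bigr => i _ do rewrite -mulmxA mxtrace_mulC -mulmxA.
rewrite -raddf_sum -mulmx_sumr.
have deltaC (i k : 'I_n) : delta_mx i k = (delta_mx k i : 'M[C]_n) ^t*.
  by rewrite trmx_delta map_delta_mx.
suff -> : \sum_i delta_mx j i *m adjacency G (delta_mx i j) = 0.
  by rewrite mulmx0 raddf0.
under eq_bigr => i _ do
  rewrite deltaC [in adjacency G _]deltaC adjacency_real -map_mxM -trmx_mul.
rewrite -(raddf_sum (map_mx _)) -(raddf_sum trmx).
have /= := adjacency_loopless G j j; rewrite /schur_prod => ->.
by rewrite trmx0 map_mx0.
Qed.

Lemma directv_opspace G : (0 < n)%N -> directv (opspace G + <[1%:M]>).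
Proof.
move=> n_gt0; apply/directv_addP/eqP; rewrite -subv0.
apply/subvP => x /memv_capP[Sx /vlineP[a xE]].
have := opspace_trace0 Sx; rewrite xE scalemx1 mxtrace_scalar => /eqP.
by rewrite mulrn_eq0 eqn0Ngt n_gt0 /= => /eqP ->; rewrite raddf0 mem0v.
Qed.

End Clique.

Section SymmetricAntisymmetric.
Variables (C : numClosedFieldType) (n : nat).
Implicit Types (A B : 'M[C]_n -> 'M[C]_n) (x y : 'M[C]_n) (i j : 'I_n).

Definition sym_adj x := 2^-1 *: ((\tr x)%:M + x^T) - n%:R^-1 *: x.
Definition asym_adj x := 2^-1 *: ((\tr x)%:M - x^T).

Fact sym_adj_is_linear : linear sym_adj.
Proof.
move=> a x y; apply/matrixP => i j; rewrite /sym_adj !linearP /= !mxE.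
by case: (i == j); rewrite ?mulr1n ?mulr0n; ring.
Qed.
HB.instance Definition _ :=
  GRing.isLinear.Build C 'M[C]_n 'M[C]_n _ sym_adj sym_adj_is_linear.

Fact asym_adj_is_linear : linear asym_adj.
Proof.
move=> a x y; apply/matrixP => i j; rewrite /asym_adj !linearP /= !mxE.
by case: (i == j); rewrite ?mulr1n ?mulr0n; ring.
Qed.
HB.instance Definition _ :=
  GRing.isLinear.Build C 'M[C]_n 'M[C]_n _ asym_adj asym_adj_is_linear.

Definition sym_space : {vspace 'M[C]_n} :=
  (lker (linfun (trmx \- idfun : 'M[C]_n -> 'M[C]_n))
   :&: lker (linfun (mxtrace : 'M[C]_n -> C^o)))%VS.
Definition asym_space : {vspace 'M[C]_n} :=
  lker (linfun (trmx \+ idfun : 'M[C]_n -> 'M[C]_n)).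

Lemma mem_sym_space x : (x \in sym_space) = (x^T == x) && (\tr x == 0).
Proof. by rewrite memv_cap !memv_ker !lfunE /= subr_eq0. Qed.

Lemma mem_asym_space x : (x \in asym_space) = (x^T == - x).
Proof. by rewrite memv_ker !lfunE /= addr_eq0. Qed.

Let T x : 'M[C]_n := (\tr x)%:M.
Let tp x : 'M[C]_n := x^T.

Let trd i j : \tr (delta_mx i j : 'M[C]_n) = (i == j)%:R.
Proof.
rewrite /mxtrace (bigD1 i) //= mxE eqxx /= big1 ?addr0 // => k /negbTE ki.
by rewrite mxE ki.
Qed.

Let mul_delta i j k l :
  delta_mx i j *m delta_mx k l = (j == k)%:R *: (delta_mx i l : 'M[C]_n).
Proof.
have [->|/negbTE jk] := eqVneq j k; first by rewrite mul_delta_mx scale1r.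
by rewrite mul_delta_mx_cond jk scale0r.
Qed.

Let sumdl i (F : 'I_n -> 'M[C]_n) : \sum_k (i == k)%:R *: F k = F i.
Proof.
rewrite (bigD1 i) //= eqxx scale1r big1 ?addr0 // => k.
by rewrite eq_sym => /negbTE ->; rewrite scale0r.
Qed.

Let sumdr i (F : 'I_n -> 'M[C]_n) : \sum_k (k == i)%:R *: F k = F i.
Proof. by under eq_bigr => k _ do rewrite eq_sym; rewrite sumdl. Qed.

Let delta_mul_delta (i j k l : 'I_n) x :
  delta_mx i j *m x *m delta_mx k l = x j k *: (delta_mx i l : 'M[C]_n).
Proof.
rewrite [in LHS](matrix_sum_delta x) mulmx_sumr mulmx_suml.
rewrite -[RHS](sumdl j (fun a => x a k *: delta_mx i l)).
apply: eq_bigr => a _; rewrite mulmx_sumr mulmx_suml.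
rewrite -(sumdr k (fun b => x a b *: delta_mx i l)) scaler_sumr.
apply: eq_bigr => b _; rewrite -scalemxAr -scalemxAl mul_delta -scalemxAl.
by rewrite mul_delta !scalerA; congr (_ *: _); ring.
Qed.

Let schurTB B i j : schur_prod T B i j = B (delta_mx i j).
Proof.
rewrite /schur_prod /T.
by under eq_bigr => k _ do rewrite trd mul_scalar_mx; rewrite sumdl.
Qed.

Let schurAT A i j : schur_prod A T i j = A (delta_mx i j).
Proof.
rewrite /schur_prod /T.
by under eq_bigr => k _ do rewrite trd mul_mx_scalar; rewrite sumdr.
Qed.

Let schurtt i j : schur_prod tp tp i j = T (delta_mx i j).
Proof.
rewrite /schur_prod /T /tp trd.
under eq_bigr => k _ do rewrite !trmx_delta mul_delta.
rewrite -scaler_sumr -scalemx1; congr (_ *: _).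
by rewrite mx1_sum_delta.
Qed.

Let schurti i j : schur_prod tp id i j = delta_mx i j.
Proof.
rewrite /schur_prod /tp.
by under eq_bigr => k _ do rewrite trmx_delta mul_delta; rewrite sumdl.
Qed.

Let schurit i j : schur_prod id tp i j = delta_mx i j.
Proof.
rewrite /schur_prod /tp.
by under eq_bigr => k _ do rewrite trmx_delta mul_delta; rewrite sumdr.
Qed.

Let schurii i j : schur_prod id id i j = n%:R *: (delta_mx i j : 'M[C]_n).
Proof.
rewrite /schur_prod; under eq_bigr => k _ do rewrite mul_delta_mx.
by rewrite sumr_const card_ord scaler_nat.
Qed.

Let projT x : space_proj T x = x.
Proof.
rewrite /space_proj /T -[RHS]mulmx1 mx1_sum_delta mulmx_sumr.
apply: eq_bigr => i _.
under eq_bigr => j _ do rewrite trd mul_scalar_mx -scalemxAl.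
by rewrite sumdl.
Qed.

Let projt x : space_proj tp x = x^T.
Proof.
rewrite /space_proj /tp [x^T]matrix_sum_delta exchange_big /=; apply: eq_bigr => i _.
by apply: eq_bigr => j _; rewrite trmx_delta delta_mul_delta mxE.
Qed.

Let proji x : space_proj id x = (\tr x)%:M.
Proof.
rewrite /space_proj -scalemx1 mx1_sum_delta scaler_sumr.
apply: eq_bigr => i _; rewrite /mxtrace scaler_suml.
by apply: eq_bigr => j _; rewrite delta_mul_delta.
Qed.

Let schurl a b c A1 A2 A3 B i j :
  schur_prod (fun x => a *: A1 x + b *: A2 x + c *: A3 x) B i j =
  a *: schur_prod A1 B i j + b *: schur_prod A2 B i j
  + c *: schur_prod A3 B i j.
Proof.
rewrite /schur_prod !scaler_sumr -!big_split /=; apply: eq_bigr => k _.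
by rewrite !mulmxDl !scalemxAl.
Qed.

Let schurr a b c A B1 B2 B3 i j :
  schur_prod A (fun x => a *: B1 x + b *: B2 x + c *: B3 x) i j =
  a *: schur_prod A B1 i j + b *: schur_prod A B2 i j
  + c *: schur_prod A B3 i j.
Proof.
rewrite /schur_prod !scaler_sumr -!big_split /=; apply: eq_bigr => k _.
by rewrite !mulmxDr !scalemxAr.
Qed.

Let projl a b c A1 A2 A3 x :
  space_proj (fun x => a *: A1 x + b *: A2 x + c *: A3 x) x =
  a *: space_proj A1 x + b *: space_proj A2 x + c *: space_proj A3 x.
Proof.
rewrite /space_proj !scaler_sumr -!big_split /=; apply: eq_bigr => i _.
rewrite !scaler_sumr -!big_split /=; apply: eq_bigr => j _.
by rewrite !mulmxDl !scalemxAl.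
Qed.

Let symE : (linfun sym_adj : _ -> _)
  = (fun x => 2^-1 *: T x + 2^-1 *: tp x + (- n%:R^-1) *: id x).
Proof. by apply/funext => x; rewrite lfunE /= /sym_adj scalerDr scaleNr. Qed.

Let asymE : (linfun asym_adj : _ -> _)
  = (fun x => 2^-1 *: T x + (- 2^-1) *: tp x + 0 *: id x).
Proof.
apply/funext => x.
by rewrite lfunE /= /asym_adj scalerBr scaleNr scale0r addr0.
Qed.

Let n_neq0 i : (n%:R : C) != 0.
Proof. by rewrite pnatr_eq0 -lt0n; case: i => i; case: n. Qed.

Fact sym_idem i j : schur_prod (linfun sym_adj) (linfun sym_adj) i j
  = linfun sym_adj (delta_mx i j).
Proof.
rewrite symE schurl !schurr !schurTB !schurAT schurtt schurti schurit schurii.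
have n0 := n_neq0 i.
by apply/matrixP => k l; rewrite !mxE; field.
Qed.

Fact asym_idem i j : schur_prod (linfun asym_adj) (linfun asym_adj) i j
  = linfun asym_adj (delta_mx i j).
Proof.
rewrite asymE schurl !schurr !schurTB !schurAT schurtt schurti schurit schurii.
by apply/matrixP => k l; rewrite !mxE; field.
Qed.

Fact sym_loopless i j : schur_prod (linfun sym_adj) id i j = 0.
Proof.
rewrite symE schurl schurTB schurti schurii; have n0 := n_neq0 i.
by apply/matrixP => k l; rewrite !mxE; field.
Qed.

Fact asym_loopless i j : schur_prod (linfun asym_adj) id i j = 0.
Proof.
rewrite asymE schurl schurTB schurti schurii.
by apply/matrixP => k l; rewrite !mxE; field.
Qed.

Let trC x : \tr (x ^t*) = (\tr x)^*.
Proof. by rewrite /mxtrace rmorph_sum; apply: eq_bigr => i _; rewrite !mxE. Qed.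

Fact sym_real x : linfun sym_adj (x ^t*) = (linfun sym_adj x) ^t*.
Proof.
rewrite !lfunE /= /sym_adj trC; apply/matrixP => i j; rewrite !mxE.
by rewrite !(fmorphV, rmorph_nat, rmorphB, rmorphM, rmorphD, rmorphMn) eq_sym.
Qed.

Fact asym_real x : linfun asym_adj (x ^t*) = (linfun asym_adj x) ^t*.
Proof.
rewrite !lfunE /= /asym_adj trC; apply/matrixP => i j; rewrite !mxE.
by rewrite !(fmorphV, rmorph_nat, rmorphB, rmorphM, rmorphD, rmorphMn) eq_sym.
Qed.

Let tr_tp x y : \tr (x^T *m y) = \tr (x *m y^T).
Proof. by rewrite -mxtrace_tr trmx_mul trmxK mxtrace_mulC. Qed.

Fact sym_undirected x y :
  \tr (linfun sym_adj x *m y) = \tr (x *m linfun sym_adj y).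
Proof.
rewrite !symE /T /tp !(mulmxDl, mulmxDr) -!scalemxAl -!scalemxAr !linearD /=.
rewrite !linearZ /= tr_tp mul_scalar_mx mul_mx_scalar !linearZ /=.
by rewrite [\tr x * _]mulrC.
Qed.

Fact asym_undirected x y :
  \tr (linfun asym_adj x *m y) = \tr (x *m linfun asym_adj y).
Proof.
rewrite !asymE /T /tp !(mulmxDl, mulmxDr) -!scalemxAl -!scalemxAr !linearD /=.
rewrite !linearZ /= tr_tp mul_scalar_mx mul_mx_scalar !linearZ /=.
by rewrite [\tr x * _]mulrC.
Qed.

Let half_eq (a b : C) : 2^-1 * a + 2^-1 * b = a -> b = a.
Proof.
move=> e; have -> : b = 2 * (2^-1 * a + 2^-1 * b) - a by field.
by rewrite e; ring.
Qed.

Fact sym_opspaceP x :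
  (x \in sym_space) = (space_proj (linfun sym_adj) x == x).
Proof.
rewrite symE projl projT projt proji mem_sym_space.
apply/andP/eqP => [[/eqP xT /eqP x0]|e].
  by rewrite xT x0 raddf0 scaler0 addr0 -scalerDl -div1r -splitr scale1r.
have x0 : \tr x = 0.
  have /(congr1 mxtrace) := e.
  rewrite !linearD /= !linearZ /= mxtrace_tr mxtrace_scalar -mulrDl.
  rewrite -div1r -splitr mul1r => /eqP.
  rewrite -[X in _ == X]addr0 (inj_eq (addrI _)).
  have [n0 _|n_gt0] := posnP n.
    by rewrite /mxtrace big1 // => i; have := ltn_ord i; rewrite {2}n0.
  rewrite mulNr oppr_eq0 mulf_eq0 invr_eq0 pnatr_eq0 eqn0Ngt n_gt0 /=.
  by rewrite mulrn_eq0 eqn0Ngt n_gt0 /= => /eqP.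
rewrite x0 eqxx; split=> //; apply/eqP/matrixP => i j.
apply: half_eq; have /matrixP/(_ i j) := e.
by rewrite x0 raddf0 scaler0 addr0 !mxE.
Qed.

Fact asym_opspaceP x :
  (x \in asym_space) = (space_proj (linfun asym_adj) x == x).
Proof.
rewrite asymE projl projT projt mem_asym_space scale0r addr0.
apply/eqP/eqP => [->|e].
  by rewrite scaleNr scalerN opprK -scalerDl -div1r -splitr scale1r.
apply/matrixP => i j; rewrite [RHS]mxE; apply/eqP; rewrite -eqr_oppLR; apply/eqP.
apply: half_eq; have /matrixP/(_ i j) := e.
by rewrite !mxE mulrN mulNr.
Qed.

Definition Gsym : quantum_graph C n :=
  QuantumGraph sym_idem sym_real sym_undirected sym_loopless sym_opspaceP.
Definition Gasym : quantum_graph C n :=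
  QuantumGraph asym_idem asym_real asym_undirected asym_loopless asym_opspaceP.

Lemma adjacency_Gsym x :
  adjacency Gsym x = 2^-1 *: ((\tr x)%:M + x^T) - n%:R^-1 *: x.
Proof. by rewrite lfunE. Qed.

Lemma adjacency_Gasym x : adjacency Gasym x = 2^-1 *: ((\tr x)%:M - x^T).
Proof. by rewrite lfunE. Qed.

Lemma opspace_Gsym x : (x \in opspace Gsym) = (x^T == x) && (\tr x == 0).
Proof. exact: mem_sym_space. Qed.

Lemma opspace_Gasym x : (x \in opspace Gasym) = (x^T == - x).
Proof. exact: mem_asym_space. Qed.

End SymmetricAntisymmetric.

(* Main.v *)
(** Let [W] be the range of a projector [P] of rank [k].  The space
    [S + C I] consists of all symmetric matrices, resp. of the antisymmetric
    matrices and the scalars, so [P] is a clique exactly when no nonzero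
    [Z = P Z P] is antisymmetric, resp. symmetric of trace zero.  Such a [Z]
    lives on the intersection of [W] and its complex conjugate, the range of
    [P^T], and exists as soon as this intersection, whose dimension is at least
    [2k - n], has dimension 2; hence [k <= uphalf n].  Conversely the bound is
    attained when [W] and its conjugate meet in at most a line and span
    everything: [W] is the nonnegative spectral subspace of an antisymmetric
    Hermitian [A] with [A^3 = A] and kernel of dimension at most 1. *)
Require Import Defs.
From mathcomp Require Import all_boot all_order all_algebra.
From mathcomp Require Import reals complex ring zify.

Import Order.TTheory GRing.Theory Num.Theory.

Section CliqueNumber.
Set Implicit Arguments.
Unset Strict Implicit.
Local Open Scope ring_scope.
Local Open Scope sesquilinear_scope.
Variables (C : numClosedFieldType) (n : nat).
Implicit Types (P x s A E Z : 'M[C]_n) (G : quantum_graph C n).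

(** * Cliques and trace duality *)

Lemma mxtrace_mul_adjoint_eq0 Z : \tr (Z *m Z ^t*) = 0 -> Z = 0.
Proof.
rewrite /mxtrace => tr0.
have Zge0 i j : 0 <= Z i j * (Z ^t*) j i by rewrite !mxE mul_conjC_ge0.
have rowge0 i : 0 <= (Z *m Z ^t*) i i by rewrite mxE sumr_ge0.
apply/matrixP => i j; apply/eqP; rewrite [X in _ == X]mxE -mul_conjC_eq0.
have := psumr_eq0P (fun i _ => rowge0 i) tr0 (i:=i) isT.
rewrite mxE => row0; have := psumr_eq0P (fun j _ => Zge0 i j) row0 (i:=j) isT.
by rewrite !mxE => ->; rewrite eqxx.
Qed.

(** Since [P *m Z *m P = Z], the trace of [Z *m x] sees only the compression of [x]. The clique
    property replaces [Z ^t*] by some [s] with the same compression, so the squared Hilbert-Schmidt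
    norm of [Z] vanishes. *)
Lemma clique_compressed_orthogonal_eq0 G k P Z : is_clique G k P ->
  P *m Z *m P = Z ->
  (forall s, s \in (opspace G + <[1%:M]>)%VS -> \tr (Z *m s) = 0) -> Z = 0.
Proof.
move=> [_ _ clP] PZ Zs0; apply: mxtrace_mul_adjoint_eq0.
have : compress P (Z ^t*) \in (compress P @: (opspace G + <[1%:M]>))%VS.
  by rewrite clP memv_img // memvf.
case/memv_imgP => s /Zs0; rewrite !compressE => trs e.
have PZtr x : \tr (Z *m x) = \tr (Z *m (P *m x *m P)).
  by rewrite -{1}PZ -!mulmxA mxtrace_mulC -!mulmxA.
by rewrite PZtr e -PZtr.
Qed.

Lemma clique_of_preimage G P : projector P ->
  (forall x, exists2 s, s \in (opspace G + <[1%:M]>)%VS &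
     P *m s *m P = P *m x *m P) ->
  is_clique G (\rank P) P.
Proof.
move=> prP sP; split=> //; apply/eqP; rewrite eqEsubv limgS ?subvf //=.
apply/subvP => _ /memv_imgP[x _ ->]; have [s Ss e] := sP x.
by apply/memv_imgP; exists s; rewrite // !compressE.
Qed.

Lemma mem_opspace_Gsym_add1 s : (0 < n)%N ->
  (s \in (opspace (Gsym C n) + <[1%:M]>)%VS) = (s^T == s).
Proof.
move=> n_gt0; apply/memv_addP/eqP => [[y]|sT].
  rewrite opspace_Gsym => /andP[/eqP yT _] [_ /vlineP[a ->] ->].
  by rewrite linearD /= linearZ /= trmx1 yT.
exists (s - (\tr s / n%:R) *: 1%:M); last first.
  exists ((\tr s / n%:R) *: 1%:M); first by rewrite memvZ // memv_line.
  by rewrite subrK.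
rewrite opspace_Gsym !linearB /= !linearZ /= trmx1 sT eqxx /=.
by rewrite mxtrace1 divfK ?subrr // pnatr_eq0 -lt0n.
Qed.

Lemma mem_opspace_Gasym_add1 s :
  reflect (exists a, (s - a%:M)^T = - (s - a%:M))
    (s \in (opspace (Gasym C n) + <[1%:M]>)%VS).
Proof.
apply: (iffP memv_addP) => [[y]|[a sa]].
  rewrite opspace_Gasym => /eqP yT [_ /vlineP[a ->] ->].
  by exists a; rewrite scalemx1 addrK.
exists (s - a%:M); first by rewrite opspace_Gasym sa.
exists a%:M; last by rewrite subrK.
by rewrite -[a%:M]scalemx1 memvZ // memv_line.
Qed.

(** * Upper bound: obstructing matrices *)

Lemma mxtrace_delta_mul d (i j : 'I_d) (B : 'M[C]_d) :
  \tr (delta_mx i j *m B) = B j i.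
Proof.
rewrite /mxtrace (bigD1 i) //= big1 ?addr0 => [|k /negbTE ki].
  rewrite mxE (bigD1 j) //= big1 ?addr0 => [|l /negbTE lj].
    by rewrite mxE !eqxx mul1r.
  by rewrite mxE lj andbF mul0r.
by rewrite mxE big1 // => l _; rewrite mxE ki mul0r.
Qed.

Lemma antisym_mx_neq0 d : (1 < d)%N ->
  exists2 M : 'M[C]_d, M^T = - M & M != 0.
Proof.
case: d => [|[|d]] // _; exists (delta_mx ord0 ord_max - delta_mx ord_max ord0).
  by rewrite linearB /= !trmx_delta opprB.
apply/eqP => /matrixP/(_ ord0 ord_max)/eqP.
by rewrite !mxE /= eqxx subr0 oner_eq0.
Qed.

Lemma sym_orthogonal_mx_neq0 d (B : 'M[C]_d) : (1 < d)%N -> B^T = B ->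
  exists2 M : 'M[C]_d, M^T = M /\ \tr (M *m B) = 0 & M != 0.
Proof.
case: d B => [|[|d]] // B _ /matrixP BT.
pose i : 'I_d.+2 := ord0; pose j : 'I_d.+2 := ord_max.
have [B0|B0] := eqVneq (B i i) 0.
  exists (delta_mx i i); first by rewrite trmx_delta mxtrace_delta_mul.
  by apply/eqP => /matrixP/(_ i i)/eqP; rewrite !mxE eqxx oner_eq0.
(* Pairing with [B] gives [2 B i j B i i - B i i (B j i + B i j)], zero by symmetry; the entry
   [- B i i] at [(i, j)] is nonzero. *)
exists ((B i j *+ 2) *: delta_mx i i - B i i *: (delta_mx i j + delta_mx j i)).
  split.
    rewrite linearB /= !linearZ /= linearD /= !trmx_delta.
    by rewrite [delta_mx j i + _]addrC.
  rewrite mulmxBl -!scalemxAl mulmxDl linearB /= !linearZ /= linearD /=.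
  by rewrite !mxtrace_delta_mul -[B j i]BT mxE; ring.
apply/eqP => /matrixP/(_ i j)/eqP; rewrite !mxE /= eqxx mulr0 sub0r addr0 mulr1.
by rewrite oppr_eq0 (negbTE B0).
Qed.

Lemma projector_submx m P (B : 'M[C]_(m, n)) :
  P *m P = P -> (B <= P)%MS -> B *m P = B.
Proof. by move=> PP /submxP[D ->]; rewrite -mulmxA PP. Qed.

(** The rows of [K] are a basis of the intersection of the row spaces of [P] and [P^T], of dimension
    at least [2 * \rank P - n], hence at least 2. *)
Lemma conj_invariant_rows P : projector P -> (uphalf n < \rank P)%N ->
  exists d, (1 < d)%N /\ exists2 K : 'M[C]_(d, n), row_free K &
    K *m P = K /\ P *m K^T = K^T.
Proof.
move=> [PP _] rP; pose I := (P :&: P^T)%MS; exists (\rank I); split.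
  have := mxrank_sum_cap P P^T; rewrite mxrank_tr => e.
  have := rank_leq_col (P + P^T)%MS; rewrite -/I in e.
  have := uphalf_half n; have := odd_double_half n; case: (odd n) => /=; lia.
exists (row_base I); first exact: row_base_free.
have KI : (row_base I <= I)%MS by rewrite eq_row_base.
split; first by apply: projector_submx => //; apply: submx_trans KI (capmxSl _ _).
rewrite -[P]trmxK -trmx_mul projector_submx -?trmx_mul ?PP //.
exact: submx_trans KI (capmxSr _ _).
Qed.

Lemma row_free_conjugate_neq0 d (K : 'M[C]_(d, n)) (M : 'M[C]_d) :
  row_free K -> M != 0 -> K^T *m M *m K != 0.
Proof.
move=> /row_freeP[L KL]; apply: contra_neq => Z0.
have : L^T *m (K^T *m M *m K) *m L = M.
  by rewrite !mulmxA -trmx_mul KL trmx1 mul1mx -mulmxA KL mulmx1.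
by rewrite Z0 mulmx0 mul0mx.
Qed.

Lemma rank_clique_Gsym k P : (0 < n)%N ->
  is_clique (Gsym C n) k P -> (k <= uphalf n)%N.
Proof.
move=> n_gt0 clP; have [prP <- _] := clP; rewrite leqNgt; apply/negP.
case/(conj_invariant_rows prP) => d [d_gt1 [K Kfree [KP PK]]].
have [M MT M0] := antisym_mx_neq0 d_gt1.
have /eqP := row_free_conjugate_neq0 Kfree M0; apply.
apply: (clique_compressed_orthogonal_eq0 clP).
  by rewrite !mulmxA PK -mulmxA KP.
move=> s; rewrite mem_opspace_Gsym_add1 // => /eqP sT.
have ZT : (K^T *m M *m K)^T = - (K^T *m M *m K).
  by rewrite !trmx_mul trmxK MT mulNmx mulmxN mulmxA.
apply/eqP; rewrite -eqNr -[X in _ == X]mxtrace_tr trmx_mul ZT sT.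
by rewrite mulmxN linearN /= mxtrace_mulC.
Qed.

Lemma rank_clique_Gasym k P :
  is_clique (Gasym C n) k P -> (k <= uphalf n)%N.
Proof.
move=> clP; have [prP <- _] := clP; rewrite leqNgt; apply/negP.
case/(conj_invariant_rows prP) => d [d_gt1 [K Kfree [KP PK]]].
(* With this [B], cyclicity of the trace turns orthogonality into [\tr (K^T *m M *m K) = 0], which
   handles the scalar part of [s]. *)
have [|M [MT MK0] M0] := sym_orthogonal_mx_neq0 (B := K *m K^T) d_gt1.
  by rewrite trmx_mul trmxK.
have /eqP := row_free_conjugate_neq0 Kfree M0; apply.
apply: (clique_compressed_orthogonal_eq0 clP).
  by rewrite !mulmxA PK -mulmxA KP.
move=> s /mem_opspace_Gasym_add1[a sT].
have ZT : (K^T *m M *m K)^T = K^T *m M *m K.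
  by rewrite !trmx_mul trmxK MT mulmxA.
have Z0 : \tr (K^T *m M *m K) = 0.
  by rewrite -mulmxA mxtrace_mulC -mulmxA.
rewrite -[s](subrK a%:M) mulmxDr mul_mx_scalar linearD /= linearZ /= Z0 mulr0.
rewrite addr0; apply/eqP; rewrite -eqNr -[X in _ == X]mxtrace_tr trmx_mul ZT sT.
by rewrite mulNmx linearN /= mxtrace_mulC.
Qed.

(** * Extremal cliques from a Hermitian antisymmetric matrix *)

Section Extremal.
Variables (A : 'M[C]_n) (u : 'rV[C]_n).
Hypotheses (AH : A ^t* = A) (AT : A^T = - A).
Hypotheses (AA : A *m A = 1%:M - u^T *m u) (uA : u *m A = 0).

Let E := u^T *m u.
(** [E] projects onto the kernel of [A], whose other eigenvalues are 1 and -1; so [P] is 1 on the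
    kernel and on the eigenspace of 1, and 0 on that of -1. Transposition negates [A] and exchanges
    the last two. *)
Let P := 2^-1 *: (1%:M + E + A).

Let EA : E *m A = 0. Proof. by rewrite /E -mulmxA uA mulmx0. Qed.

Let AE : A *m E = 0.
Proof. by rewrite /E mulmxA -[A]trmxK -trmx_mul AT mulmxN uA oppr0 trmx0 mul0mx. Qed.

Let EAA : E = 1%:M - A *m A. Proof. by rewrite AA opprB addrC subrK. Qed.

Let EE : E *m E = E.
Proof. by rewrite {2}EAA mulmxBr mulmx1 mulmxA EA mul0mx subr0. Qed.

Let ET : E^T = E. Proof. by rewrite /E trmx_mul trmxK. Qed.

Let PE : P *m E = E.
Proof.
rewrite /P -scalemxAl !mulmxDl mul1mx EE AE.
by apply/matrixP => i j; rewrite !mxE; field.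
Qed.

Let EP : E *m P = E.
Proof.
rewrite /P -scalemxAr !mulmxDr mulmx1 EE EA.
by apply/matrixP => i j; rewrite !mxE; field.
Qed.

Let PT : P^T = 1%:M + E - P.
Proof.
rewrite /P linearZ /= !linearD /= trmx1 ET AT.
by apply/matrixP => i j; rewrite !mxE; field.
Qed.

Let PP : P *m P = P.
Proof.
rewrite {1}/P -scalemxAl !mulmxDl mul1mx EP /P -scalemxAr !mulmxDr mulmx1 AE AA -/E.
by apply/matrixP => i j; rewrite !mxE; field.
Qed.

Let EH : E ^t* = E.
Proof.
by rewrite EAA linearB /= trmx1 trmx_mul map_mxB map_mx1 map_mxM AH.
Qed.

Let projP : projector P.
Proof.
split=> //; rewrite /P !scalerDr !linearD /= !linearZ /= trmx1.
by rewrite !map_mxD !map_mxZ map_mx1 EH AH fmorphV rmorph_nat.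
Qed.

Let PPT : P *m P^T = E.
Proof. by rewrite PT mulmxBr mulmxDr mulmx1 PE PP addrC addKr. Qed.

Let PTP : P^T *m P = E.
Proof. by rewrite PT mulmxBl mulmxDl mul1mx EP PP addrC addKr. Qed.

(** The matrix is [E *m x^T *m E], and [E] has rank at most 1. *)
Let compress_tr x : exists a, P *m (P *m x *m P)^T *m P = a *: E.
Proof.
exists ((u *m x^T *m u^T) 0 0); rewrite !trmx_mul !mulmxA PPT -!mulmxA PTP.
by rewrite /E scalemxAr -mul_scalar_mx -mx11_scalar !mulmxA.
Qed.

Lemma rank_extremal_ge : (uphalf n <= \rank P)%N.
Proof.
have : (1%:M <= P + P^T)%MS.
  have -> : 1%:M = (1%:M - E) *m P + P^T.
    by rewrite PT mulmxBl mul1mx EP addrC addrA subrK addrK.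
  by apply: addmx_sub_adds; rewrite ?submxMl.
move/mxrankS; rewrite mxrank1 => n_le.
have := leq_trans n_le (mxrank_adds_leqif P P^T); rewrite mxrank_tr addnn.
by rewrite leq_uphalf_double.
Qed.

Lemma clique_Gsym_extremal : (0 < n)%N -> is_clique (Gsym C n) (\rank P) P.
Proof.
move=> n_gt0; apply: clique_of_preimage => // x.
have [a ea] := compress_tr x; set y := P *m x *m P in ea *.
(* The symmetric [y + y^T] compresses to [y + a *: E]; the excess is symmetric and fixed by
   compression. *)
exists (y + y^T - a *: E).
  rewrite mem_opspace_Gsym_add1 // linearB linearD linearZ /= ET trmxK.
  by rewrite [y^T + y]addrC.
rewrite mulmxBr mulmxDr mulmxBl mulmxDl ea -(scalemxAr a P) PE -(scalemxAl a E) EP addrK.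
by rewrite /y -!mulmxA PP !mulmxA PP.
Qed.

(* [P = E + Q] with [Q Q^T = 0], so the scalars yield the missing [E] as the
   compression of [1 - (Q - Q^T)]. *)
Lemma clique_Gasym_extremal : is_clique (Gasym C n) (\rank P) P.
Proof.
apply: clique_of_preimage => // x.
have [a ea] := compress_tr x; set y := P *m x *m P in ea *.
exists (y - y^T + a *: (1%:M - (P - P^T))).
  apply/mem_opspace_Gasym_add1; exists a.
  rewrite -[a%:M]scalemx1; apply/matrixP => i j; rewrite !mxE [j == i]eq_sym; ring.
rewrite mulmxDr mulmxBr mulmxDl mulmxBl ea -(scalemxAr a P) -(scalemxAl a _ P).
rewrite mulmxBr mulmx1 mulmxBr PP PPT subKr EP subrK.
by rewrite /y -!mulmxA PP !mulmxA PP.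
Qed.
End Extremal.

(** Up to sign, a Pauli matrix [sigma_y] on each pair of indices exchanged by reversal, and 0 on a
    middle index. *)
Definition skew_rev : 'M[C]_n :=
  \matrix_(i, j) ((j == rev_ord i)%:R * ('i * ((i < j)%N%:R - (j < i)%N%:R))).

(** The basis vector of the middle index for odd [n], zero for even [n]. *)
Definition fixed_rev : 'rV[C]_n := \row_j (j == rev_ord j)%:R.

Lemma skew_rev_tr : skew_rev^T = - skew_rev.
Proof.
apply/matrixP => i j; rewrite !mxE [j == _]eq_sym (can2_eq rev_ordK rev_ordK); ring.
Qed.

Lemma skew_rev_adj : skew_rev ^t* = skew_rev.
Proof.
rewrite skew_rev_tr; apply/matrixP => i j; rewrite !mxE.
by rewrite rmorphN !rmorphM rmorphB !rmorph_nat /= conjCi; ring.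
Qed.

Lemma fixed_skew_rev : fixed_rev *m skew_rev = 0.
Proof.
apply/matrixP => i j; rewrite !mxE big1 // => k _; rewrite !mxE.
have [-> |] := eqVneq j (rev_ord k); last by rewrite mul0r mulr0.
have [<- |] := eqVneq k (rev_ord k); last by rewrite mul0r.
by rewrite ltnn subrr !mulr0.
Qed.

Lemma skew_rev_sqr :
  skew_rev *m skew_rev = 1%:M - fixed_rev^T *m fixed_rev.
Proof.
apply/matrixP => i l; rewrite !mxE (bigD1 (rev_ord i)) //= big1 => [|j /negbTE ji].
  rewrite !mxE big_ord1 !mxE eqxx rev_ordK addr0 [i == l]eq_sym.
  have [->|li] := eqVneq l i.
    have [e|ne] := eqVneq i (rev_ord i); first by rewrite -e !ltnn /=; ring.
    have [_|_|/val_inj e] := ltngtP i (rev_ord i); last by rewrite -e eqxx in ne.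
      by rewrite /=; ring: (mulCii C).
    by rewrite /=; ring: (mulCii C).
  (* Off the diagonal the product of the two indicators vanishes, as reversal has at most one fixed
     point. *)
  have [il|_] := eqVneq i (rev_ord i); last by rewrite /=; ring.
  have [ll|_] := eqVneq l (rev_ord l); last by rewrite /=; ring.
  case/eqP: li; apply: val_inj; have := congr1 val il; have := congr1 val ll.
  by have := ltn_ord i; have := ltn_ord l; rewrite /=; lia.
by rewrite !mxE ji !mul0r.
Qed.

End CliqueNumber.

Theorem proposition4p47 (R : realType) (n : nat) (hn : 2 <= n) :
  clique_number (Gsym R[i] n) = uphalf n /\
  clique_number (Gasym R[i] n) = uphalf n.
Proof.
have n_gt0 : 0 < n by exact: ltnW.
have rkP := rank_extremal_ge
  (skew_rev_tr R[i] n) (skew_rev_sqr R[i] n) (fixed_skew_rev R[i] n).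
split; apply/eqP; rewrite eqn_leq; apply/andP; split.
- have [[P clP] _] := clique_numberP (Gsym R[i] n).
  exact: rank_clique_Gsym clP.
- apply: leq_trans rkP _.
  apply: (clique_numberP (Gsym R[i] n)).2; apply: clique_Gsym_extremal => //.
  + exact: skew_rev_adj.
  + exact: skew_rev_tr.
  + exact: skew_rev_sqr.
  + exact: fixed_skew_rev.
- have [[P clP] _] := clique_numberP (Gasym R[i] n).
  exact: rank_clique_Gasym clP.
- apply: leq_trans rkP _.
  apply: (clique_numberP (Gasym R[i] n)).2; apply: clique_Gasym_extremal => //.
  + exact: skew_rev_adj.
  + exact: skew_rev_tr.
  + exact: skew_rev_sqr.
  + exact: fixed_skew_rev.
Qed.
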